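(* Let $A\subset \mathbb{R}$ be a finite convex set. Then $$|A+A| \gg |A|^{\frac{58}{37}} \log^{-\frac{20}{37}} |A| .$$
   Context: A finite set $A=\{a_1<a_2<\dots<a_n\}\subset\mathbb{R}$ is called convex if $a_{i+1}-a_i>a_i-a_{i-1}$ for every $i=2,\dots,n-1$. $A+A=\{a+a' : a,a'\in A\}$. The symbols $\ll,\gg$ denote inequalities up to absolute positive constants (Vinogradov notation). Logarithms are base 2. *)

(* Defs.v *)
From mathcomp Require Import all_boot all_order all_algebra.
From mathcomp Require Import finmap.
From mathcomp Require Import reals exp.
Set Implicit Arguments.
Unset Strict Implicit.
Unset Printing Implicit Defensive.
Import Order.TTheory GRing.Theory Num.Theory.
Local Open Scope ring_scope.

Definition increasing_enum (R : realType) (A : {fset R}) : seq R :=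
  sort <=%R (enum_fset A).

(* The enumeration a is 0-based: the middle terms a_2, ..., a_(n-1) of
   a_1 < ... < a_n are the a i.+1 with i.+2 < n. *)
Definition convex_fset (R : realType) (A : {fset R}) : Prop :=
  let a := nth 0 (increasing_enum A) in
  forall i : nat, (i.+2 < #|` A|)%N -> a i.+2 - a i.+1 > a i.+1 - a i.

Definition sumset (R : realType) (A B : {fset R}) : {fset R} :=
  [fset (x + y)%R | x in A, y in B]%fset.

Definition log2 (R : realType) (x : R) : R := ln x / ln 2.

(* Main.v *)
Require Import Defs.
From mathcomp Require Import all_boot all_order all_algebra.
From mathcomp Require Import finmap.
From mathcomp Require Import reals exp.
From mathcomp Require Import zify ring lra.
Set Implicit Arguments.
Unset Strict Implicit.
Unset Printing Implicit Defensive.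
Import Order.TTheory GRing.Theory Num.Theory.

(** Let n = |A|, S = A + A, and let r denote numbers of representations as a
    difference. In a convex set the gaps of a given index length are pairwise
    distinct, so a pair of nearby elements of B and the index distance of their
    translates in A determine the translation. Counting such pairs gives
    |{x : r_(A-B)(x) >= t}| << |A| |B|^2 / t^3, hence
    E(A,B) << |A| |B|^(3/2) and E_3(A) << n^3 H with H = 1 + 1/2 + ... + 1/n.

    Call a sum popular if it has >> n^2 / |S| representations and let A' be the
    set of a in A for which at least half of the sums a + b are popular; then
    |A'| >= n/2. For D = {d : r_(A'-A)(d) >= k}, every d in D gives at least
    k n / 2 triples (a, b, c) with a - c = d and a + b popular.
    Cauchy-Schwarz over the fibres of (a, b, c) |-> (a + b, a - c) bounds the
    squared number of triples by E_3(A) times the number of pairs (s, d) with s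
    popular, d in D and s - d in S; popularity of s bounds the latter by |S| / n^2
    times the number of solutions of a + b = s' + d, which is at most
    (E(A,D) E(A,S))^(1/2). Together with |D| << n^3 / k^3 this bounds k^2 |D|
    for all k, hence the energy E(A',A) >= |A'|^2 n^2 / |S|, and the outcome is
    n^22 << |S|^14 H^11. The exponent 11/7 exceeds 58/37, which leaves a power of
    n to absorb H. *)

(** * Cauchy-Schwarz, fibre counting and summation by layers *)

Local Open Scope nat_scope.

(** Doubling both sides and symmetrising the right double sum in (i, j) leaves the termwise
    inequality 2xy <= x^2 + y^2 with x = [f i * g j] and y = [f j * g i]. *)
Lemma cauchy_schwarz_nat (I : Type) (s : seq I) (f g : I -> nat) :
  (\sum_(i <- s) f i * g i) ^ 2
    <= (\sum_(i <- s) f i ^ 2) * (\sum_(i <- s) g i ^ 2).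
Proof.
rewrite -mulnn !big_distrlr /= -(leq_pmul2l (isT : 0 < 2)) [leqRHS]mul2n -addnn.
rewrite [X in _ <= _ + X]exchange_big -big_split big_distrr /=.
apply: leq_sum => i _; rewrite -big_split big_distrr /=.
apply: leq_sum => j _; have := nat_Cauchy (f i * g j) (f j * g i).
by case=> h _; move: h; rewrite !expnMn; nia.
Qed.

Lemma sum_eq_indicator (K : eqType) (s : seq K) (y : K) (g : K -> nat) :
  uniq s -> \sum_(x <- s) (y == x) * g x = (y \in s) * g y.
Proof.
elim: s => [|x s IH] /=; first by rewrite big_nil.
case/andP=> xs us; rewrite big_cons IH // in_cons.
by case: eqP => [->|_] /=; rewrite ?(negbTE xs) ?addn0.
Qed.

Lemma sum_indicator_le1 (K : eqType) (s : seq K) (P : pred K) :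
  uniq s -> {in s &, forall x y, P x -> P y -> x = y} ->
  \sum_(x <- s) P x <= 1.
Proof.
elim: s => [|x s IH] /=; first by rewrite big_nil.
case/andP=> xs us inj; rewrite big_cons.
have [Px|nPx] := boolP (P x).
  rewrite big1_seq // => y /andP[_ ys]; apply/eqP; rewrite eqb0.
  apply/negP => Py; move: xs; rewrite (inj x y) ?ys //.
    by rewrite inE eqxx.
  by rewrite inE ys orbT.
rewrite add0n; apply: IH => // y z ys zs; apply: inj; rewrite inE ?ys ?zs orbT //.
Qed.

(** The squared fibre sizes add up to the number of pairs with equal [key]. Fibres are taken in all
    of [s]; [p] only confines the relevant keys to [Q]. *)
Lemma cauchy_schwarz_fibres (I : Type) (K : eqType) (s : seq I) (Q : seq K)
    (key : I -> K) (p : pred I) :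
  uniq Q -> (forall i, p i -> key i \in Q) ->
  (\sum_(i <- s) p i) ^ 2
    <= size Q * \sum_(i <- s) \sum_(j <- s) (key i == key j).
Proof.
move=> uQ pQ; pose F q := \sum_(i <- s) (key i == q).
have leF : \sum_(i <- s) p i <= \sum_(q <- Q) F q * 1.
  rewrite (eq_bigr F) => [|q _]; last by rewrite muln1.
  rewrite exchange_big; apply: leq_sum => i _ /=.
  have [pi|//] := boolP (p i).
  under eq_bigr do rewrite -[nat_of_bool _]muln1.
  by rewrite (@sum_eq_indicator _ Q (key i) (fun=> 1) uQ) pQ.
have le2 : (\sum_(i <- s) p i) ^ 2 <= (\sum_(q <- Q) F q * 1) ^ 2.
  by rewrite leq_exp2r; [exact: leF|].
apply: leq_trans le2 (leq_trans (cauchy_schwarz_nat _ _ _) _).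
rewrite sum1_size mulnC leq_mul2l; apply/orP; right.
rewrite (eq_bigr (fun q => \sum_(i <- s) \sum_(j <- s) (key i == q) * (key j == q))).
  rewrite exchange_big; apply: leq_sum => i _ /=.
  rewrite exchange_big; apply: leq_sum => j _ /=.
  rewrite (@sum_eq_indicator _ Q (key i) (fun q => key j == q)) //.
  by rewrite [key j == _]eq_sym; case: (_ \in _); rewrite ?mul1n ?mul0n.
by move=> q _; rewrite -mulnn /F big_distrlr.
Qed.

(** Discrete integration by layers: [w] dominates the growth of [f], and the two sums are exchanged.
    It turns bounds on level sets into bounds on moments. *)
Lemma layer_cake (K : Type) (s : seq K) (r : K -> nat) (f w : nat -> nat) n :
  (forall x, r x <= n) -> (forall m, f m <= \sum_(t < m) w t) ->
  \sum_(x <- s) f (r x) <= \sum_(t < n) w t * \sum_(x <- s) (t < r x).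
Proof.
move=> rn fw; under [leqRHS]eq_bigr do rewrite big_distrr /=.
rewrite exchange_big; apply: leq_sum => x _ /=.
apply: leq_trans (fw _) _; rewrite (big_ord_widen n) // big_mkcond /=.
by apply: leq_sum => t _; case: ifP; rewrite ?muln1.
Qed.

(** * Representation counts for a general operation, shared by sums and differences *)

Definition nrep (K L M : eqType) (h : K -> L -> M) (s : seq K) (t : seq L) (x : M) : nat :=
  \sum_(a <- s) \sum_(b <- t) (h a b == x).

Local Notation rep := (nrep (fun a b => a - b)%R).

Lemma sum_nrep (K L M : eqType) (h : K -> L -> M) s t (X : seq M) g :
  uniq X ->
  \sum_(x <- X) nrep h s t x * g x
    = \sum_(a <- s) \sum_(b <- t) (h a b \in X) * g (h a b).
Proof.
move=> uX; under eq_bigr do rewrite big_distrl /=.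
rewrite exchange_big; apply: eq_bigr => a _ /=.
under eq_bigr do rewrite big_distrl /=.
by rewrite exchange_big; apply: eq_bigr => b _ /=; rewrite sum_eq_indicator.
Qed.

Lemma sum_nrep_le (K L M : eqType) (h : K -> L -> M) s t (X : seq M) :
  uniq X -> \sum_(x <- X) nrep h s t x <= size s * size t.
Proof.
move=> uX; rewrite (eq_bigr (fun x => nrep h s t x * 1)) => [|x _]; last by rewrite muln1.
rewrite sum_nrep // -[size s]sum1_size big_distrl /=; apply: leq_sum => a _.
by rewrite -[size t]sum1_size mul1n; apply: leq_sum => b _; case: (_ \in _).
Qed.

Section Rep.
Variable V : zmodType.
Implicit Types s t : seq V.

Lemma repE s t x : uniq s ->
  rep s t x = \sum_(b <- t) (b + x \in s)%R.
Proof.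
move=> us; rewrite /nrep exchange_big; apply: eq_bigr => b _ /=.
under eq_bigr do rewrite subr_eq addrC eq_sym -[nat_of_bool _]muln1.
by rewrite (@sum_eq_indicator _ s (b + x)%R (fun=> 1)) // muln1.
Qed.

Lemma rep_size s t x : uniq s -> rep s t x = size [seq b <- t | (b + x)%R \in s].
Proof.
by move=> us; rewrite repE // -sum1_size big_filter [RHS]big_mkcond; apply: eq_bigr => b _; case: ifP.
Qed.

Lemma rep_opp s t x : rep s t x = rep t s (- x)%R.
Proof.
rewrite /nrep exchange_big; apply: eq_bigr => b _; apply: eq_bigr => a _ /=.
by rewrite -eqr_oppLR opprB.
Qed.

Lemma rep_leq s t x : uniq s -> uniq t -> rep s t x <= size s.
Proof.
move=> us ut; rewrite rep_opp rep_size // size_filter; exact: count_size.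
Qed.
End Rep.

(** * Gaps of convex sequences and close pairs of solutions *)

Section Convex.
Variable R : realDomainType.
Implicit Types s t : seq R.

Definition convex_seq s :=
  forall i, i.+2 < size s -> (s`_i.+1 - s`_i < s`_i.+2 - s`_i.+1)%R.

(** Consecutive gaps increase strictly, and a gap of index length [m] is a sum of [m] consecutive
    ones. *)
Lemma convex_seq_gap_lt s i j m : convex_seq s -> 0 < m -> i < j -> j + m < size s ->
  (s`_(i + m) - s`_i < s`_(j + m) - s`_j)%R.
Proof.
move=> cs; have gap k l : k < l -> l.+1 < size s ->
    (s`_k.+1 - s`_k < s`_l.+1 - s`_l)%R.
  elim: l => // l IH; rewrite ltnS leq_eqVlt => /orP[/eqP->|kl] ls; first exact: cs.
  by apply: lt_trans (cs _ ls); apply: IH => //; lia.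
move=> m0 ij; elim: m m0 => // -[_ _|m IH _] jm.
  by rewrite !addn1 gap //; lia.
rewrite !(addnS _ m.+1).
have := IH isT; rewrite !addnS => /(_ ltac:(lia)) h1.
have := gap (i + m).+1 (j + m).+1; rewrite !addnS in jm *.
move=> /(_ ltac:(lia) ltac:(lia)) h2; lra.
Qed.

Lemma convex_seq_gap_inj s i j m : convex_seq s -> 0 < m ->
  i + m < size s -> j + m < size s ->
  (s`_(i + m) - s`_i = s`_(j + m) - s`_j)%R -> i = j.
Proof.
move=> cs m0 im jm e; case: (ltngtP i j) => // h.
  by have := convex_seq_gap_lt cs m0 h jm; rewrite e ltxx.
by have := convex_seq_gap_lt cs m0 h im; rewrite e ltxx.
Qed.

Lemma sorted_index_lt s x y : sorted <%R s -> x \in s -> y \in s -> (x < y)%R ->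
  index x s < index y s.
Proof.
move=> ss xs ys xy; rewrite ltnNge; apply/negP => h.
have ss' : sorted <=%R s by apply: sub_sorted ss => ? ? /ltW.
have := sorted_leq_index le_trans lexx ss' y x ys xs h.
by rewrite leNgt xy.
Qed.

(** The increments telescope to at most [f m], and each large one contributes at least [K.+1]. *)
Lemma card_large_gaps (f : nat -> nat) m N K :
  (forall l, l < m -> f l <= f l.+1) -> f m <= N ->
  (\sum_(l < m) (K < f l.+1 - f l)) * K.+1 <= N.
Proof.
move=> fle fm; apply: leq_trans fm.
have -> : f m = f 0 + \sum_(l < m) (f l.+1 - f l).
  elim: m fle => [|m IH] fle; first by rewrite big_ord0 addn0.
  by rewrite big_ord_recr /= addnA -IH => [|l lm]; [rewrite subnKC ?fle|apply: fle; lia].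
apply: leq_trans (leq_addl _ _); rewrite big_distrl; apply: leq_sum => l _ /=.
by case: ltnP; lia.
Qed.

Section Level.
Variables (s t : seq R) (x : R).
Hypotheses (ss : sorted <%R s) (ts : sorted <%R t).

(* The element of t at index distance k.+1 from b is translated by x to the
   element of s at index distance m.+1 from b + x. *)
Definition close_pair (b : R) (k m : nat) : bool :=
  [&& (b + x)%R \in s, index (b + x)%R s + m.+1 < size s
    & (t`_(index b t + k.+1) + x == s`_(index (b + x) s + m.+1))%R].

(* The consecutive solutions b in t of b + x \in s have total index gap at most
   size t in t and size s in s, so at least a quarter of them are close. *)
Lemma rep_le_close_pairs (r : nat) KA KB : 1 < r -> r <= rep s t x ->
  4 * size s < KA.+1 * r -> 4 * size t < KB.+1 * r ->
  r <= 4 * \sum_(b <- t) \sum_(k < KB) \sum_(m < KA) close_pair b k m.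
Proof.
have us : uniq s by rewrite lt_sorted_uniq.
have ut : uniq t by rewrite lt_sorted_uniq.
rewrite rep_size //; set u := [seq b <- t | _] => r1 ru hA hB.
have {}ru : (r <= size u)%N by exact: ru.
have uu : sorted <%R u by apply: sorted_filter => //; apply: lt_trans.
have usz l : l < size u -> (u`_l \in t)%R /\ (u`_l + x \in s)%R.
  by move=> lu; have := mem_nth 0%R lu; rewrite mem_filter => /andP[-> ->].
have ult l : l.+1 < size u -> (u`_l < u`_l.+1)%R.
  by move=> lu; apply: (sortedP 0%R uu).
set F := fun b => \sum_(k < KB) \sum_(m < KA) close_pair b k m.
have -> : \sum_(b <- t) \sum_(k < KB) \sum_(m < KA) close_pair b k m = \sum_(b <- t) F b by [].
have leF : \sum_(l < (size u).-1) F (u`_l)%R <= \sum_(b <- t) F b.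
  apply: (@leq_trans (\sum_(b <- u) F b)).
    rewrite (big_nth 0%R) big_mkord (big_ord_widen (size u) (fun l => F (u`_l)%R)) ?leq_pred // big_mkcond /=.
    by apply: leq_sum => l _; case: ifP.
  by rewrite big_filter big_mkcond; apply: leq_sum => b _; case: ifP.
pose f l := index (u`_l + x)%R s; pose g l := index (u`_l)%R t.
have flt l : l.+1 < size u -> f l < f l.+1.
  move=> lu; have [_ h1] := usz l (ltnW lu); have [_ h2] := usz l.+1 lu.
  by apply: sorted_index_lt => //; rewrite ltrD2r ult.
have glt l : l.+1 < size u -> g l < g l.+1.
  move=> lu; have [h1 _] := usz l (ltnW lu); have [h2 _] := usz l.+1 lu.
  by apply: sorted_index_lt => //; rewrite ult.
have flS l : l < size u -> f l < size s by move=> /usz [_ h]; rewrite index_mem.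
have glS l : l < size u -> g l < size t by move=> /usz [h _]; rewrite index_mem.
pose L := (size u).-1.
have badA : (\sum_(l < L) (KA < f l.+1 - f l)) * KA.+1 <= size s.
  apply: card_large_gaps => [l lL|]; first by apply/ltnW/flt; rewrite /L in lL; lia.
  by apply/ltnW/flS; rewrite /L; lia.
have badB : (\sum_(l < L) (KB < g l.+1 - g l)) * KB.+1 <= size t.
  apply: card_large_gaps => [l lL|]; first by apply/ltnW/glt; rewrite /L in lL; lia.
  by apply/ltnW/glS; rewrite /L; lia.
(* Each consecutive pair of solutions is close, or jumps too far in [s], or jumps too far in [t]. *)
have good : L <= \sum_(l < L) F (u`_l)%R + \sum_(l < L) (KA < f l.+1 - f l)
                 + \sum_(l < L) (KB < g l.+1 - g l).
  rewrite -!big_split /= -[leqLHS]card_ord -sum1_card; apply: leq_sum => l _.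
  case: (ltnP KA) => [|hfA]; first by rewrite addn1 addSn.
  case: (ltnP KB) => [|hgB]; first by rewrite addn1.
  rewrite !addn0; have lu : l.+1 < size u by case: l {hfA hgB} => l /=; rewrite /L; lia.
  have hf := flt l lu; have hg := glt l lu.
  have kK : (g l.+1 - g l).-1 < KB by lia.
  have mK : (f l.+1 - f l).-1 < KA by lia.
  rewrite /F (bigD1 (Ordinal kK)) //= (bigD1 (Ordinal mK)) //=.
  suff -> : close_pair (u`_l)%R (g l.+1 - g l).-1 (f l.+1 - f l).-1 by rewrite -addnA.
  have [h1 h2] := usz l (ltnW lu); have [h3 h4] := usz l.+1 lu.
  rewrite /close_pair h2 /= -/(f l) -/(g l) !prednK ?subn_gt0 // !subnKC ?(ltnW hf) ?(ltnW hg) //.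
  by rewrite flS //= /f /g !nth_index.
have bA : 4 * \sum_(l < L) (KA < f l.+1 - f l) < r by nia.
have bB : 4 * \sum_(l < L) (KB < g l.+1 - g l) < r by nia.
(* There are at least r - 1 consecutive pairs, and at most (r - 1) / 2 of them are bad; four times
   the rest is at least 2(r - 1) >= r, as r > 1. *)
move: good leF bA bB ru; rewrite /L; lia.
Qed.

End Level.
End Convex.

(** * Level sets and moments of difference representations *)

Section Energy.
Variable R : realDomainType.
Implicit Types s t T : seq R.

(* b, k and m determine the gap of index length m.+1 in s, hence by convexity its
   left endpoint b + x. *)
Lemma sum_close_pair_le1 s t T b k m : convex_seq s -> uniq T ->
  \sum_(x <- T) close_pair s t x b k m <= 1.
Proof.
move=> cs uT; apply: sum_indicator_le1 => // x y _ _.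
move=> /and3P[xs xl /eqP xe] /and3P[ys yl /eqP ye].
have e : index (b + x)%R s = index (b + y)%R s.
  apply: (convex_seq_gap_inj cs (ltn0Sn m)) => //.
  by rewrite -xe -ye !nth_index //; ring.
by apply: (addrI b); rewrite -(nth_index 0%R xs) e nth_index.
Qed.

(** Each triple (b, k, m) is a close pair for at most one x in [T], so |T| r <= 4 |t| KB KA. Since
    KA r <= 4 |s| and KB r <= 4 |t|, the constant is 4 * 4 * 4 = 64. *)
Lemma rep_level_bound s t T r : sorted <%R s -> convex_seq s -> sorted <%R t ->
  uniq T -> (forall x, x \in T -> r <= rep s t x) ->
  size T * r ^ 3 <= 64 * size s * size t ^ 2.
Proof.
move=> ss cs ts uT Tr.
(* A single solution gives no consecutive pair; here the trivial count of all pairs suffices. *)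
case: (leqP r 1) => r1.
  have {r1} : size T * r <= size s * size t /\ (r = 0 \/ r = 1).
    split; last by lia.
    apply: leq_trans (@sum_nrep_le _ _ _ (fun a b => a - b)%R s t T uT).
    by rewrite -sum1_size big_distrl /= big_seq [leqRHS]big_seq; apply: leq_sum => x /Tr; rewrite mul1n.
  by case=> h [rE|rE]; subst r; [rewrite muln0|move: h; rewrite muln1; nia].
pose KA := (4 * size s) %/ r; pose KB := (4 * size t) %/ r.
have r0 : 0 < r by lia.
have hA : 4 * size s < KA.+1 * r by rewrite ltn_ceil.
have hB : 4 * size t < KB.+1 * r by rewrite ltn_ceil.
have hA' : KA * r <= 4 * size s by rewrite leq_trunc_div.
have hB' : KB * r <= 4 * size t by rewrite leq_trunc_div.
have h : size T * r <= 4 * (size t * (KB * KA)).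
  have -> : size T * r = \sum_(x <- T) r by rewrite big_const_seq count_predT iter_addn_0 mulnC.
  apply: (@leq_trans (\sum_(x <- T) 4 * \sum_(b <- t) \sum_(k < KB) \sum_(m < KA) close_pair s t x b k m)).
    rewrite big_seq [leqRHS]big_seq; apply: leq_sum => x /Tr xr.
    exact: rep_le_close_pairs.
  rewrite -big_distrr /= leq_mul2l exchange_big /=.
  rewrite -[size t]sum1_size big_distrl; apply: leq_sum => b _ /=.
  rewrite mul1n exchange_big /=.
  rewrite -[X in X * _](card_ord KB) -sum1_card big_distrl; apply: leq_sum => k _ /=.
  rewrite mul1n exchange_big /= -[X in _ <= X](card_ord KA) -sum1_card; apply: leq_sum => m _ /=.
  exact: sum_close_pair_le1.
have : size T * r ^ 3 <= 4 * (size t * ((KB * r) * (KA * r))) by nia.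
move=> h2; apply: leq_trans h2 _.
have h3 := leq_mul hB' hA'.
have -> : 64 * size s * size t ^ 2 = 4 * (size t * (4 * size t * (4 * size s))) by ring.
by rewrite !leq_mul2l h3 !orbT.
Qed.


Lemma count_rep_level s t T k : sorted <%R s -> convex_seq s -> sorted <%R t ->
  uniq T -> (\sum_(x <- T) (k < rep s t x)) * k.+1 ^ 3 <= 64 * size s * size t ^ 2.
Proof.
move=> ss cs ts uT.
have -> : \sum_(x <- T) (k < rep s t x) = size [seq x <- T | k < rep s t x].
  by rewrite -sum1_size big_filter [RHS]big_mkcond; apply: eq_bigr => x _; case: ifP.
apply: rep_level_bound => //; first exact: filter_uniq.
by move=> x; rewrite mem_filter => /andP[].
Qed.

Lemma sum_inv_sqr_tail (F : realFieldType) (y n : nat) : 0 < y ->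
  (\sum_(k < n) (y <= k)%N%:R * (k.+1%:R ^+ 2)^-1 <= y%:R^-1 :> F)%R.
Proof.
move=> y0; have yp : (0 < y%:R :> F)%R by rewrite ltr0n.
(* The claim is strengthened to a telescoping form, with 1/(k+1)^2 <= 1/k - 1/(k+1); [maxn] covers n
   < y, where the sum vanishes. *)
suff h : (\sum_(k < n) (y <= k)%N%:R * (k.+1%:R ^+ 2)^-1
           <= y%:R^-1 - (maxn y n)%:R^-1 :> F)%R.
  by apply: le_trans h _; rewrite gerBl invr_ge0.
elim: n => [|n IH]; first by rewrite big_ord0 maxn0 subrr.
rewrite big_ord_recr /=; case: leqP => yn; last first.
  rewrite mul0r addr0; apply: le_trans IH _.
  have -> : maxn y n.+1 = y by lia.
  by have -> : maxn y n = y by lia.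
have mE : maxn y n = n by lia.
have mSE : maxn y n.+1 = n.+1 by lia.
rewrite mE in IH; rewrite mSE mul1r.
have np : (0 < n%:R :> F)%R by rewrite ltr0n; lia.
have e : (n%:R^-1 - n.+1%:R^-1 = (n%:R * n.+1%:R)^-1 :> F)%R.
  rewrite -natr1; field; rewrite natr1 !gt_eqF //=.
have : ((n.+1%:R ^+ 2)^-1 <= (n%:R * n.+1%:R)^-1 :> F)%R.
  by rewrite lef_pV2 ?posrE ?mulr_gt0 ?exprn_gt0 // expr2 ler_pM2r // ler_nat.
by move=> h; apply: le_trans (lerD IH h) _; rewrite -e addrA subrK.
Qed.

(** The energy bound |s| |t|^(3/2), squared to stay in the natural numbers. Values up to a height y
    cost at most y |s| |t| in total; the layers above y cost at most 128 |s| |t|^2 / y by the level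
    bound. *)
Lemma second_moment_bound s t T : sorted <%R s -> convex_seq s -> sorted <%R t ->
  uniq T ->
  (\sum_(x <- T) rep s t x ^ 2) ^ 2 <= 132 ^ 2 * (size s ^ 2 * size t ^ 3).
Proof.
move=> ss cs ts uT; set n := size s; set m := size t; set E := \sum_(x <- T) _.
have us : uniq s by rewrite lt_sorted_uniq.
have ut : uniq t by rewrite lt_sorted_uniq.
case: (posnP m) => [m0|m0].
  suff -> : E = 0 by [].
  rewrite /E big1 // => x _; rewrite rep_size //.
  by rewrite (size0nil m0).
(* [y] is of order the square root of [m], which balances the two terms of
   [E_split] *)
pose y := 2 ^ (trunc_log 4 m).+1.
have y2 : y ^ 2 = 4 ^ (trunc_log 4 m).+1 by rewrite -expnM mulnC expnM.
have /andP[ym1 ym2] : m <= y ^ 2 <= 4 * m.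
  have /andP[h1 h2] := trunc_log_bounds (isT : 1 < 4) m0.
  by rewrite y2 ltnW //= expnS leq_mul2l h1.
have y0 : 0 < y by rewrite expn_gt0.
pose c k := \sum_(x <- T) (k < rep s t x).
pose tail := \sum_(k < n) (y <= k) * (2 * k.+1) * c k.
have E_split : E <= y * (n * m) + tail.
  (* The truncated excess [r ^ 2 - y * r] is zero for r <= y, so only the layers k >= y enter
     [tail]. *)
  apply: (@leq_trans (\sum_(x <- T) (y * rep s t x + (rep s t x ^ 2 - y * rep s t x)))).
    by apply: leq_sum => x _; rewrite -leq_subLR.
  rewrite big_split -big_distrr /=; apply: leq_add; first by rewrite leq_mul2l sum_nrep_le // orbT.
  apply: (@layer_cake _ T (rep s t) (fun r => r ^ 2 - y * r) (fun k => (y <= k) * (2 * k.+1))).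
    by move=> x; apply: rep_leq.
  elim=> [|r IH]; first by rewrite big_ord0.
  rewrite big_ord_recr /=; case: (leqP y r) => yr.
    rewrite mul1n; move: IH; set Z := \sum_(_ < _) _; rewrite -!mulnn; nia.
  by rewrite (leq_trans _ (leq0n _)) // leqn0 subn_eq0 -mulnn leq_mul2r yr orbT.
have tail_le : y * tail <= 128 * (n * m ^ 2).
  rewrite -(ler_nat rat) natrM mulrC -ler_pdivlMr ?ltr0n //.
  have yp : (0 < y%:R :> rat)%R by rewrite ltr0n.
  apply: (@le_trans _ _ ((128 * (n * m ^ 2))%:R *
     \sum_(k < n) (y <= k)%N%:R * (k.+1%:R ^+ 2)^-1)%R); last first.
    by rewrite ler_wpM2l ?ler0n // sum_inv_sqr_tail.
  rewrite /tail natr_sum mulr_sumr; apply: ler_sum => k _.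
  have kp : (0 < k.+1%:R ^+ 2 :> rat)%R by rewrite exprn_gt0 // ltr0n.
  have h : 2 * k.+1 * c k * k.+1 ^ 2 <= 128 * (n * m ^ 2).
    have := count_rep_level (k : nat) ss cs ts uT; rewrite -/(c k) -/n -/m.
    rewrite -(leq_pmul2l (isT : 0 < 2)) => h; apply: leq_trans (leq_trans h _); apply: eq_leq.
      by rewrite !expnS expn0; ring.
    by ring.
  rewrite -(ler_nat rat) natrM natrX in h.
  case: (y <= k); last by rewrite !mul0n mul0r mulr0.
  by rewrite !mul1n mul1r ler_pdivlMr.
(* 132 = 4 + 128: the 4 comes from y^2 <= 4m, the 128 from [tail_le]. *)
have yE : y * E <= 132 * (n * m ^ 2).
  have : y * E <= y * (y * (n * m) + tail) by rewrite leq_mul2l E_split orbT.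
  have : y ^ 2 * (n * m) <= 4 * m * (n * m) by rewrite leq_mul2r ym2 orbT.
  rewrite -!mulnn; nia.
(* Since m <= y^2, a factor m takes the place of y^2 and then cancels. *)
have : m * E ^ 2 <= m * (132 ^ 2 * (n ^ 2 * m ^ 3)).
  apply: (@leq_trans ((y * E) ^ 2)); first by rewrite expnMn leq_mul2r ym1 orbT.
  apply: (@leq_trans ((132 * (n * m ^ 2)) ^ 2)); first by rewrite leq_exp2r.
  rewrite !expnMn; apply: eq_leq; ring.
by rewrite leq_pmul2l.
Qed.

(** Layer k has weight 3(k+1)^2 and size at most 64 n^3 / (k+1)^3, so it contributes at most 192 n^3
    / (k+1). *)
Lemma third_moment_bound (F : realFieldType) s T : sorted <%R s -> convex_seq s ->
  uniq T ->
  ((\sum_(x <- T) rep s s x ^ 3)%N%:R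
     <= 192 * (size s)%:R ^+ 3 * \sum_(k < size s) k.+1%:R^-1 :> F)%R.
Proof.
move=> ss cs uT; have us : uniq s by rewrite lt_sorted_uniq.
set n := size s.
have h : \sum_(x <- T) rep s s x ^ 3
    <= \sum_(k < n) 3 * k.+1 ^ 2 * \sum_(x <- T) (k < rep s s x).
  apply: (@layer_cake _ T (rep s s) (fun r => r ^ 3) (fun k => 3 * k.+1 ^ 2)).
    by move=> x; apply: rep_leq.
  elim=> [|r IH]; first by rewrite big_ord0.
  rewrite big_ord_recr /=; apply: leq_trans (leq_add IH (leqnn _)).
  rewrite !expnS expn0; nia.
rewrite -(ler_nat F) in h; apply: le_trans h _.
rewrite natr_sum mulr_sumr; apply: ler_sum => k _.
set c := \sum_(x <- T) _.
have h : 3 * k.+1 ^ 2 * c * k.+1 <= 192 * n ^ 3.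
  have := count_rep_level (k : nat) ss cs ss uT; rewrite -/c -/n.
  rewrite -(leq_pmul2l (isT : 0 < 3)) => h; apply: leq_trans (leq_trans h _); apply: eq_leq.
    by rewrite !expnS expn0; ring.
  by rewrite !expnS expn0; ring.
by rewrite ler_pdivlMr ?ltr0n // -natrX -!natrM ler_nat.
Qed.

End Energy.

(** * Popular sums, rich elements and the triple count *)

Lemma subr_eq_sub (V : zmodType) (x y z w : V) :
  (x - y == z - w)%R = (z + y == w + x)%R.
Proof. by rewrite subr_eq addrAC eq_sym subr_eq (addrC w). Qed.

Section Sumset.
Variables (V : zmodType) (A S : seq V).
Hypothesis uS : uniq S.
Hypothesis AS : forall a b, a \in A -> b \in A -> (a + b)%R \in S.

Definition rep_sum : V -> nat := nrep (fun a b => a + b)%R A A.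

(** The threshold is a quarter of the average |A|^2 / |S|, cleared of the division. *)
Definition popular (x : V) : bool := size A ^ 2 <= 4 * size S * rep_sum x.

(** This is the set A' of the introduction. *)
Definition rich : seq V :=
  [seq a <- A | size A <= 2 * \sum_(b <- A) popular (a + b)%R].

Definition diffs (s t : seq V) : seq V := undup [seq (a - b)%R | a <- s, b <- t].

Lemma mem_diffs (s t : seq V) a b : a \in s -> b \in t -> (a - b)%R \in diffs s t.
Proof. by move=> sa tb; rewrite mem_undup; apply: allpairs_f. Qed.

(** At most |S| sums are unpopular, and each accounts for fewer than |A|^2 / (4 |S|) pairs. *)
Lemma unpopular_pairs :
  4 * \sum_(a <- A) \sum_(b <- A) ~~ popular (a + b)%R <= size A ^ 2.
Proof.
have eqS : \sum_(a <- A) \sum_(b <- A) ~~ popular (a + b)%R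
    = \sum_(x <- S) rep_sum x * ~~ popular x.
  rewrite sum_nrep // [LHS]big_seq [RHS]big_seq; apply: eq_bigr => a aA.
  by rewrite [LHS]big_seq [RHS]big_seq; apply: eq_bigr => b bA; rewrite AS ?mul1n.
have [S0|S0] := posnP (size S).
  by rewrite eqS (size0nil S0) big_nil.
rewrite -(leq_pmul2l S0) mulnCA mulnA eqS big_distrr /= -[X in _ <= X * _]sum1_size big_distrl.
apply: leq_sum => x _ /=; rewrite mul1n /popular -ltnNge mulnA.
by case: ltnP; lia.
Qed.

Lemma size_rich : size A <= 2 * size rich.
Proof.
set n := size A.
(* An element outside [rich] has strictly more than n/2 unpopular sums; the resulting factor n + 1
   is positive even for empty [A]. *)
have h : (\sum_(a <- A) (a \notin rich)) * n.+1
    <= 2 * \sum_(a <- A) \sum_(b <- A) ~~ popular (a + b)%R.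
  rewrite big_distrl big_distrr /= [leqLHS]big_seq [leqRHS]big_seq; apply: leq_sum => a aA.
  rewrite mem_filter aA andbT -ltnNge -/n; case: ltnP; rewrite ?mul0n // mul1n => lt.
  have : \sum_(b <- A) popular (a + b)%R + \sum_(b <- A) ~~ popular (a + b)%R = n.
    by rewrite -big_split /n -sum1_size; apply: eq_bigr => b _; case: popular.
  move: lt; lia.
have e : size rich + \sum_(a <- A) (a \notin rich) = n.
  rewrite -sum1_size big_filter big_mkcond /= -big_split /= /n -[RHS]sum1_size.
  rewrite [LHS]big_seq [RHS]big_seq; apply: eq_bigr => a aA.
  by rewrite mem_filter aA andbT; case: ifP.
have := unpopular_pairs; rewrite -/n.
move: h e; set B := \sum_(a <- A) \sum_(b <- A) _; set C := \sum_(a <- A) _ => h e h2.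
have h3 : 2 * (C * n.+1) <= n ^ 2 by lia.
have : 2 * C <= n by rewrite leqNgt; apply/negP => ?; move: h3; rewrite -mulnn; nia.
lia.
Qed.

Lemma sub_rich a : a \in rich -> a \in A.
Proof. by rewrite mem_filter => /andP[]. Qed.

(** Cauchy-Schwarz over the values of a + c in [S]; the equation a + c = a' + c' is then read as a -
    c' = a' - c. *)
Lemma rich_energy : (size rich * size A) ^ 2
  <= size S * \sum_(x <- diffs rich A) rep rich A x ^ 2.
Proof.
pose I := [seq (a, c) | a <- rich, c <- A].
have := @cauchy_schwarz_fibres _ _ I S (fun i => i.1 + i.2)%R (mem I) uS.
have -> : \sum_(i <- I) mem I i = size rich * size A.
  rewrite -(size_allpairs pair) -/I -sum1_size [LHS]big_seq [RHS]big_seq.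
  by apply: eq_bigr => i iI /=; rewrite iI.
move=> /(_ _)/leq_trans -> //.
  by move=> _ /allpairsP[[a c] [/sub_rich aA cA ->]]; apply: AS.
rewrite leq_mul2l; apply/orP; right.
rewrite (eq_bigr (fun x => rep rich A x * rep rich A x)) => [|x _]; last by rewrite mulnn.
rewrite sum_nrep ?undup_uniq // /I big_allpairs [leqLHS]big_seq [leqRHS]big_seq; apply: leq_sum => a aA.
have h c' : c' \in A -> ((a - c')%R \in diffs rich A) * rep rich A (a - c')%R
    = \sum_(c <- A) \sum_(a' <- rich) (a + c == a' + c')%R.
  move=> cA; rewrite mem_diffs // mul1n /nrep exchange_big; apply: eq_bigr => c _.
  by apply: eq_bigr => a' _; rewrite subr_eq_sub (addrC c').
rewrite [leqRHS]big_seq (eq_bigr _ h) -big_seq [leqRHS]exchange_big.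
by apply: leq_sum => c _ /=; rewrite big_allpairs exchange_big.
Qed.

(** The constant 16 is 4 from the popularity threshold times 2^2 from keeping half of the sums of a
    rich element. *)
Lemma triple_bound (D : seq V) k :
  uniq D -> (forall d, d \in D -> k <= rep rich A d) ->
  size A ^ 2 * (size A * (k * size D)) ^ 2
    <= 16 * size S * (\sum_(x <- diffs A D) rep A D x * rep S A x)
         * \sum_(x <- diffs A A) rep A A x ^ 3.
Proof.
move=> uD Dk; set n := size A; set W := \sum_(x <- diffs A D) _; set E := \sum_(x <- _) _.
pose I := [seq (ab, c) | ab <- [seq (a, b) | a <- A, b <- A], c <- A].
pose p (i : V * V * V) :=
  [&& i \in I, i.1.1 \in rich, (i.1.1 - i.2)%R \in D & popular (i.1.1 + i.1.2)%R].
pose key (i : V * V * V) := (i.1.1 + i.1.2, i.1.1 - i.2)%R.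
(* For x = a + b and d = a - c the difference x - d is b + c, which lies in [S]. *)
pose Q := [seq q <- [seq (x, d) | x <- S, d <- D] | popular q.1 && ((q.1 - q.2)%R \in S)].
have uQ : uniq Q by rewrite filter_uniq // allpairs_uniq // => -[? ?] [? ?] _ _ [-> ->].
have bigI (F : V * V * V -> nat) :
    \sum_(i <- I) F i = \sum_(a <- A) \sum_(b <- A) \sum_(c <- A) F (a, b, c).
  by rewrite big_allpairs big_allpairs.
have memI a b c : a \in A -> b \in A -> c \in A -> (a, b, c) \in I.
  by move=> aA bA cA; apply: allpairs_f => //; apply: allpairs_f.
have N_ge : n * (k * size D) <= 2 * \sum_(i <- I) p i.
  have -> : \sum_(i <- I) p i
      = \sum_(a <- rich) \sum_(c <- A) ((a - c)%R \in D) * \sum_(b <- A) popular (a + b)%R.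
    rewrite bigI [RHS]big_filter [RHS]big_mkcond [LHS]big_seq [RHS]big_seq; apply: eq_bigr => a aA.
    rewrite exchange_big; case: ifP => ra /=; last first.
      rewrite big1 // => c _; rewrite big1 // => b _.
      by rewrite /p /= mem_filter ra /= andbF.
    rewrite [LHS]big_seq [RHS]big_seq; apply: eq_bigr => c cA.
    rewrite big_distrr [LHS]big_seq [RHS]big_seq; apply: eq_bigr => b bA.
    by rewrite /p /= memI // mem_filter ra aA /= mulnb.
  apply: (@leq_trans (n * \sum_(a <- rich) \sum_(c <- A) ((a - c)%R \in D))).
    rewrite leq_mul2l; apply/orP; right.
    have <- : \sum_(d <- D) rep rich A d * 1 = \sum_(a <- rich) \sum_(c <- A) ((a - c)%R \in D).
      rewrite (@sum_nrep _ _ _ _ _ _ _ (fun=> 1)) //; apply: eq_bigr => a _.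
      by apply: eq_bigr => c _; rewrite muln1.
    rewrite -sum1_size big_distrr /= [leqLHS]big_seq [leqRHS]big_seq; apply: leq_sum => d /Dk.
    by rewrite !muln1.
  rewrite !big_distrr /= [leqLHS]big_seq [leqRHS]big_seq; apply: leq_sum => a.
  rewrite mem_filter => /andP[ha _]; rewrite !big_distrr /=; apply: leq_sum => c _.
  by rewrite mulnCA mulnC leq_mul2l ha orbT.
have N_le : (\sum_(i <- I) p i) ^ 2 <= size Q * E.
  apply: leq_trans (cauchy_schwarz_fibres I (key := key) uQ _) _.
    move=> [[a b] c] /and4P[iI _ /= dD pop]; rewrite mem_filter /= pop.
    case/allpairsP: iI => -[[a' b'] c'] [/allpairsP[[a'' b''] [/= aA bA [ea eb]]] /= cA [ea' eb' ec]].
    subst; apply/andP; split; last by apply: allpairs_f; rewrite ?AS.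
    by rewrite opprB addrC addrA subrK AS.
  rewrite leq_mul2l; apply/orP; right.
  (* Equal keys mean b' - b = a - a' = c - c', so for given a and a' the remaining entries are two
     independent representations of a - a'. *)
  have -> : E = \sum_(a <- A) \sum_(a' <- A) rep A A (a - a')%R ^ 2.
    rewrite /E (eq_bigr (fun x => rep A A x * rep A A x ^ 2)) => [|x _]; last by rewrite -expnS.
    rewrite sum_nrep ?undup_uniq // [LHS]big_seq [RHS]big_seq; apply: eq_bigr => a aA.
    rewrite [LHS]big_seq [RHS]big_seq; apply: eq_bigr => b bA.
    by rewrite mem_diffs // mul1n.
  rewrite bigI; apply: leq_sum => a _.
  under eq_bigr => b _ do under eq_bigr => c _ do rewrite bigI.
  rewrite (eq_bigr (fun b => \sum_(a' <- A) \sum_(c <- A) \sum_(b' <- A) \sum_(c' <- A)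
      (key (a, b, c) == key (a', b', c')))) => [|b _]; last by rewrite exchange_big.
  rewrite exchange_big; apply: leq_sum => a' _ /=.
  rewrite -mulnn {1}/nrep [X in _ <= X * _]exchange_big big_distrl /=; apply: leq_sum => b _.
  rewrite /nrep mulnC big_distrl /=; apply: leq_sum => c _.
  rewrite big_distrlr /= exchange_big /=; apply: leq_sum => c' _; apply: leq_sum => b' _.
  rewrite /key /= xpair_eqE mulnb andbC.
  by rewrite !subr_eq_sub [in leqLHS]eq_sym (addrC c').
have Q_le : n ^ 2 * size Q <= 4 * size S * W.
  (* In a + b - d the pair (a, d) is grouped by x = a - d; the condition on b then reads b + x in
     [S]. *)
  have -> : W = \sum_(a <- A) \sum_(b <- A) \sum_(d <- D) ((a + b - d)%R \in S).
    rewrite /W sum_nrep ?undup_uniq // [LHS]big_seq [RHS]big_seq; apply: eq_bigr => a aA.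
    rewrite [RHS]exchange_big [LHS]big_seq [RHS]big_seq; apply: eq_bigr => d dD.
    rewrite mem_diffs // mul1n repE //; apply: eq_bigr => b _.
    by rewrite addrA (addrC b).
  apply: (@leq_trans (4 * size S * \sum_(x <- S) rep_sum x * \sum_(d <- D) ((x - d)%R \in S))).
    rewrite -sum1_size big_filter big_mkcond /= big_allpairs !big_distrr.
    apply: leq_sum => x _ /=; rewrite mulnA [leqLHS]big_distrr [leqRHS]big_distrr; apply: leq_sum => d _ /=.
    case: ifP => [/andP[pop ->]|_]; last by rewrite muln0.
    by rewrite !muln1; exact: pop.
  apply: leq_mul => //; rewrite /rep_sum sum_nrep //.
  apply: leq_sum => a _; apply: leq_sum => b _.
  by case: (_ \in S); rewrite ?mul1n.
have : n ^ 2 * (2 * \sum_(i <- I) p i) ^ 2 <= 16 * size S * W * E.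
  apply: (@leq_trans (4 * (n ^ 2 * size Q) * E)).
    by rewrite expnMn mulnCA -(mulnA 4) -(mulnA (n ^ 2)) leq_mul // leq_mul.
  apply: leq_mul => //; have -> : 16 * size S * W = 4 * (4 * size S * W) by ring.
  exact: leq_mul.
by apply: leq_trans; rewrite leq_mul2l leq_exp2r // N_ge orbT.
Qed.
End Sumset.

(** * Elimination of the auxiliary quantities from the inequalities *)

Section Algebra.
Local Open Scope ring_scope.
Variable F : realFieldType.

(** The fourth power of the triple bound, with the bounds for W^4 and E inserted, gives k^8 M^5 <<
    S^7 H^4. Multiplying by (M k^3)^2 << n^6 makes the left side a power of k^2 M. *)
Lemma level_energy_algebra (n S M k W E H c2 c3 c4 : F) :
  0 < n -> 0 <= S -> 0 <= M -> 0 <= k -> 0 <= W -> 0 <= E -> 0 <= H ->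
  0 <= c2 -> 0 <= c3 -> 0 <= c4 ->
  n ^+ 2 * (n * (k * M)) ^+ 2 <= 16 * S * W * E ->
  W ^+ 4 <= c2 * (n ^+ 4 * M ^+ 3 * S ^+ 3) ->
  E <= c3 * n ^+ 3 * H -> M * k ^+ 3 <= c4 * n ^+ 3 ->
  (k ^+ 2 * M) ^+ 7 <= (16 * c3) ^+ 4 * c2 * c4 ^+ 2 * (S ^+ 7 * H ^+ 4 * n ^+ 6).
Proof.
move=> n0 S0 M0 k0 W0 E0 H0 c20 c30 c40 hT hW hE hM.
(* The case M = 0 is separate because a factor M^3 is cancelled below. *)
move: M0; rewrite le_eqVlt => /orP[/eqP M0|M0].
  by rewrite -M0 mulr0 expr0n /= !(mulr_ge0, exprn_ge0) // ltW.
pose L := n * (n * (k * M)).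
have L0 : 0 <= L by rewrite !mulr_ge0 ?(ltW n0) ?(ltW M0).
have h1 : L ^+ 2 <= 16 * S * W * (c3 * n ^+ 3 * H).
  rewrite /L exprMn; apply: le_trans hT _; rewrite ler_wpM2l // !mulr_ge0 //.
have h2 : L ^+ 8 <= (16 * c3) ^+ 4 * S ^+ 4 * (n ^+ 12 * H ^+ 4) * W ^+ 4.
  have -> : L ^+ 8 = (L ^+ 2) ^+ 4 by rewrite -exprM.
  apply: (@le_trans _ _ ((16 * S * W * (c3 * n ^+ 3 * H)) ^+ 4)).
    by rewrite lerXn2r // nnegrE ?exprn_ge0 // (le_trans _ h1) ?exprn_ge0.
  by rewrite le_eqVlt; apply/orP; left; apply/eqP; ring.
have h3 : L ^+ 8 <= (16 * c3) ^+ 4 * S ^+ 4 * (n ^+ 12 * H ^+ 4) * (c2 * (n ^+ 4 * M ^+ 3 * S ^+ 3)).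
  by apply: le_trans h2 _; rewrite ler_wpM2l // !mulr_ge0 ?exprn_ge0 ?mulr_ge0 // ltW.
have h4 : k ^+ 8 * M ^+ 5 <= (16 * c3) ^+ 4 * c2 * (S ^+ 7 * H ^+ 4).
  have p0 : 0 < n ^+ 16 * M ^+ 3 by rewrite mulr_gt0 ?exprn_gt0.
  rewrite -(ler_pM2l p0); move: h3; rewrite /L.
  by congr (_ <= _); ring.
have h5 : (M * k ^+ 3) ^+ 2 <= (c4 * n ^+ 3) ^+ 2.
  by rewrite lerXn2r // nnegrE ?mulr_ge0 ?exprn_ge0 // ltW.
have -> : (k ^+ 2 * M) ^+ 7 = (k ^+ 8 * M ^+ 5) * (M * k ^+ 3) ^+ 2 by ring.
have -> : (16 * c3) ^+ 4 * c2 * c4 ^+ 2 * (S ^+ 7 * H ^+ 4 * n ^+ 6)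
  = ((16 * c3) ^+ 4 * c2 * (S ^+ 7 * H ^+ 4)) * (c4 * n ^+ 3) ^+ 2 by ring.
by rewrite ler_pM // ?mulr_ge0 ?exprn_ge0 ?mulr_ge0 ?exprn_ge0 // ltW.
Qed.
End Algebra.

(** * The inequality between |A|, |S| and the harmonic sum *)

Section Main.
Variables (R : realDomainType) (F : realFieldType) (A S : seq R).
Hypotheses (sA : sorted <%R A) (cA : convex_seq A) (sS : sorted <%R S).
Hypothesis AS : forall a b, a \in A -> b \in A -> (a + b)%R \in S.

Let n := size A.
Let H : F := (\sum_(k < n) k.+1%:R^-1)%R.

Let uA : uniq A. Proof. by rewrite lt_sorted_uniq. Qed.
Let uS : uniq S. Proof. by rewrite lt_sorted_uniq. Qed.

Let H_ge0 : (0 <= H)%R.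
Proof. by apply: sumr_ge0 => k _; rewrite invr_ge0. Qed.

(* The second sum is indexed by - x, since [second_moment_bound] needs the convex
   set A as the first argument of [rep]. *)
Lemma mixed_energy_bound (D X : seq R) : sorted <%R D -> uniq X ->
  (\sum_(x <- X) rep A D x * rep S A x) ^ 4
    <= 132 ^ 4 * (n ^ 4 * size D ^ 3 * size S ^ 3).
Proof.
move=> sD uX.
have h := cauchy_schwarz_nat X (rep A D) (rep S A).
have hD := second_moment_bound sA cA sD uX.
have uNX : uniq [seq (- x)%R | x <- X] by rewrite map_inj_uniq //; apply: oppr_inj.
have := second_moment_bound sA cA sS uNX.
rewrite big_map; under eq_bigr => x _ do rewrite -rep_opp.
move=> hS; rewrite (expnM _ 2 2).
apply: leq_trans (leq_trans (leq_mul hD hS) _); first by rewrite -expnMn leq_exp2r.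
by apply: eq_leq; move: 132 => z; rewrite -/n; set a := size D; set b := size S; ring.
Qed.

Let level k := [seq x <- diffs (rich A S) A | k < rep (rich A S) A x].

Lemma level_energy_bound k : 0 < n ->
  ((k.+1 ^ 2 * size (level k))%N%:R ^+ 7
    <= (16 * 192) ^+ 4 * 132 ^+ 4 * 64 ^+ 2 * ((size S)%:R ^+ 7 * H ^+ 4 * n%:R ^+ 6) :> F)%R.
Proof.
move=> n0; pose D := sort <=%R (level k).
have uD' : uniq (level k) by rewrite filter_uniq // undup_uniq.
have sD : sorted <%R D by rewrite sort_lt_sorted.
have uD : uniq D by rewrite sort_uniq.
have sizeD : size D = size (level k) by rewrite size_sort.
have repD d : d \in D -> k.+1 <= rep (rich A S) A d.
  by rewrite mem_sort mem_filter => /andP[].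
(* The level bound needs a convex first argument; [rich A S] need not be convex, so representations
   are enlarged to those by [A]. *)
have repD' d : d \in D -> k.+1 <= rep A A d.
  move=> /repD dk; apply: leq_trans dk _.
  rewrite /nrep big_filter big_mkcond; apply: leq_sum => a _ /=.
  by case: ifP.
have hT := triple_bound uS AS uD repD.
have hW := mixed_energy_bound sD (undup_uniq _ : uniq (diffs A D)).
have hE := third_moment_bound F sA cA (undup_uniq _ : uniq (diffs A A)).
have hM := rep_level_bound sA cA sA uD repD'.
move: hT hW hE hM; rewrite sizeD -/n -/H.
set M := size (level k); set W := \sum_(x <- diffs A D) _; set E := \sum_(x <- _) _ => hT hW hE hM.
rewrite natrM natrX.
apply: (@level_energy_algebra _ _ _ _ _ W%:R E%:R) => //; try exact: H_ge0.
- by rewrite ltr0n.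
- by rewrite exprn_ge0.
- by rewrite -!(natrM, natrX) ler_nat.
- by rewrite -!(natrM, natrX) ler_nat.
- by rewrite -!(natrM, natrX) ler_nat (leq_trans hM) // -mulnA -expnS.
Qed.

(** With j maximising (k+1)^2 |level k|, summation by layers gives E <= 2 e(j) H. The seventh power
    of n^4 <= 4 |S| E and the level bound give n^28 << |S|^14 H^11 n^6. *)
Lemma sumset_bound : 0 < n ->
  (n%:R ^+ 22 <= 8 ^+ 7 * ((16 * 192) ^+ 4 * 132 ^+ 4 * 64 ^+ 2)
     * ((size S)%:R ^+ 14 * H ^+ 11) :> F)%R.
Proof.
move=> n0; set c := (_ * 64 ^+ 2)%R.
pose e (k : 'I_n) := k.+1 ^ 2 * size (level k).
set E := \sum_(x <- diffs (rich A S) A) rep (rich A S) A x ^ 2.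
have nE : n ^ 4 <= 4 * size S * E.
  have h1 := rich_energy uS AS; have h2 := size_rich uS AS.
  rewrite -/n -/E in h1 h2.
  apply: (@leq_trans ((2 * size (rich A S) * n) ^ 2)).
    by rewrite (expnM n 2 2) leq_exp2r // -mulnn leq_mul2r h2 orbT.
  by rewrite -mulnA expnMn -mulnA leq_mul2l.
pose j : 'I_n := [arg max_(k > Ordinal n0) e k].
have ej k : e k <= e j by rewrite /j; case: arg_maxnP => // i _; apply.
have EH : (E%:R <= 2 * (e j)%:R * H :> F)%R.
  have h : E <= \sum_(k < n) 2 * k.+1 * \sum_(x <- diffs (rich A S) A) (k < rep (rich A S) A x).
    apply: (@layer_cake _ _ (rep (rich A S) A) (fun r => r ^ 2) (fun k => 2 * k.+1)).
      move=> x; apply: leq_trans (rep_leq _ _ _) _ => //; first exact: filter_uniq.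
      by rewrite size_filter count_size.
    elim=> [|r IH]; first by rewrite big_ord0.
    rewrite big_ord_recr /=; apply: leq_trans (leq_add IH (leqnn _)).
    rewrite !expnS expn0; nia.
  rewrite -(ler_nat F) in h; apply: le_trans h _.
  rewrite natr_sum mulr_sumr; apply: ler_sum => k _.
  rewrite ler_pdivlMr ?ltr0n // -!natrM ler_nat.
  apply: leq_trans (leq_mul (leqnn 2) (ej k)); rewrite /e /level size_filter -sum1_count.
  rewrite [in leqRHS]big_mkcond.
  by apply: eq_leq; rewrite !expnS expn0; ring.
have H0 := H_ge0.
have hj := level_energy_bound j n0; rewrite -/(e j) -/c in hj.
have np : (0 < n%:R ^+ 6 :> F)%R by rewrite exprn_gt0 // ltr0n.
rewrite -(ler_pM2r np).
have h1 : ((n%:R ^+ 4) ^+ 7 <= (4 * (size S)%:R * E%:R) ^+ 7 :> F)%R.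
  by rewrite lerXn2r ?nnegrE ?mulr_ge0 ?exprn_ge0 // -!natrM -natrX ler_nat.
have h2 : (E%:R ^+ 7 <= (2 * (e j)%:R * H) ^+ 7 :> F)%R.
  by rewrite lerXn2r ?nnegrE ?mulr_ge0.
rewrite -exprD [X in (X <= _)%R](exprM _ 4 7); apply: le_trans h1 _.
rewrite exprMn; apply: (@le_trans _ _ ((4 * (size S)%:R) ^+ 7 * (2 * (e j)%:R * H) ^+ 7)%R).
  by rewrite ler_wpM2l // exprn_ge0 // mulr_ge0.
have -> : ((4 * (size S)%:R) ^+ 7 * (2 * (e j)%:R * H) ^+ 7
  = 8 ^+ 7 * (size S)%:R ^+ 7 * H ^+ 7 * (e j)%:R ^+ 7 :> F)%R.
  set a := ((size S)%:R)%R; set b := ((e j)%:R)%R; ring.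
apply: (@le_trans _ _ (8 ^+ 7 * (size S)%:R ^+ 7 * H ^+ 7 * (c * ((size S)%:R ^+ 7 * H ^+ 4 * n%:R ^+ 6)))%R).
  by rewrite ler_wpM2l // !mulr_ge0 ?exprn_ge0.
rewrite le_eqVlt; apply/orP; left; apply/eqP; move: (c) => c'.
set a := ((size S)%:R)%R; set b := (n%:R)%R; ring.
Qed.
End Main.

(** * Growth of the harmonic sum and the final exponents *)

Local Open Scope ring_scope.

Lemma harmonic_sum_le_ln (R : realType) (n : nat) : (0 < n)%N ->
  \sum_(k < n) k.+1%:R^-1 <= 1 + ln n%:R :> R.
Proof.
case: n => // n _; elim: n => [|n IH].
  by rewrite big_ord_recl big_ord0 ln1 !addr0 invr1.
rewrite big_ord_recr /=; apply: le_trans (lerD IH (lexx _)) _.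
rewrite -addrA lerD2l -lerBrDl -lerN2 opprB.
have p1 : 0 < n.+1%:R :> R by rewrite ltr0n.
have p2 : 0 < n.+2%:R :> R by rewrite ltr0n.
rewrite -ln_div ?posrE //.
have -> : n.+1%:R / n.+2%:R = 1 + - n.+2%:R^-1 :> R.
  have e : n.+2%:R = n.+1%:R + 1 :> R by rewrite natr1.
  have p2' : n.+2%:R != 0 :> R by rewrite gt_eqF.
  by apply: (mulIf p2'); rewrite divfK // mulrDl mul1r mulNr mulVf // e addrK.
apply: le_ln1Dx; rewrite ltrN2 invf_lt1 // ltr1n //.
Qed.

Lemma ln_le_powR (R : realType) (x e : R) : 0 < e -> 0 < x ->
  ln x <= e^-1 * x `^ e.
Proof.
move=> e0 x0; rewrite mulrC ler_pdivlMr // mulrC -ln_powR ltW // ln_sublinear //.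
exact: powR_gt0.
Qed.

(** The exponent 2/407 is chosen since 407 = 11 * 37, and 205 exceeds 1 + 407/2. *)
Lemma harmonic_sum_pow11_le (R : realType) (n : nat) : (0 < n)%N ->
  (\sum_(k < n) k.+1%:R^-1) ^+ 11 <= 205 ^+ 11 * n%:R `^ (2 / 37) :> R.
Proof.
move=> n0; have N0 : 0 < n%:R :> R by rewrite ltr0n.
have N1 : 1 <= n%:R :> R by rewrite ler1n.
have h : \sum_(k < n) k.+1%:R^-1 <= 205 * n%:R `^ (2 / 407) :> R.
  apply: le_trans (harmonic_sum_le_ln R n0) _.
  have h1 := @ln_le_powR R n%:R (2 / 407) ltac:(lra) N0.
  have h2 : 1 <= n%:R `^ (2 / 407) :> R.
    by rewrite -[leLHS](powRr0 n%:R) ler_powR //; lra.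
  apply: le_trans (lerD h2 h1) _.
  move: (n%:R `^ _) h2 => y y1; rewrite invf_div; lra.
have s0 : 0 <= \sum_(k < n) k.+1%:R^-1 :> R.
  by apply: sumr_ge0 => k _; rewrite invr_ge0.
have -> : 2 / 37 = 2 / 407 * 11%:R :> R by field.
rewrite powRrM powR_mulrn ?powR_ge0 // -exprMn lerXn2r // nnegrE //.
by rewrite mulr_ge0 // powR_ge0.
Qed.

Lemma increasing_enum_sorted (R : realType) (A : {fset R}) :
  sorted <%R (increasing_enum A).
Proof. by rewrite sort_lt_sorted fset_uniq. Qed.

Theorem theorem2 (R : realType) :
  exists2 c : R, 0 < c &
    forall A : {fset R}, convex_fset A -> (1 < #|` A|)%N ->
      c * ((#|` A|)%:R `^ (58 / 37) * log2 (#|` A|)%:R `^ (- (20 / 37)))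
        <= (#|` sumset A A|)%:R.
Proof.
pose K : R := 8 ^+ 7 * ((16 * 192) ^+ 4 * 132 ^+ 4 * 64 ^+ 2).
pose C := K * 205 ^+ 11.
have K1 : 1 <= K by rewrite /K !(mulr_ege1, exprn_ege1) // -[1]/(1%:R) ler_nat.
have C1 : 1 <= C by rewrite mulr_ege1 // exprn_ege1 // ler1n.
have C0 : 0 < C by apply: lt_le_trans C1.
exists C^-1 => [|A cA n1]; first by rewrite invr_gt0.
set n := #|` A|; set S := sumset A A.
have sizeE (B : {fset R}) : size (increasing_enum B) = #|` B| by rewrite size_sort.
have n0 : (0 < n)%N by apply: ltnW.
have AS a b : a \in increasing_enum A -> b \in increasing_enum A ->
    a + b \in increasing_enum S.
  by rewrite !mem_sort => aA bA; apply: in_imfset2.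
have cA' : convex_seq (increasing_enum A).
  by move=> i; rewrite sizeE => /cA.
have := sumset_bound R (increasing_enum_sorted A) cA' (increasing_enum_sorted S) AS.
rewrite !sizeE -/n -/K => /(_ n0) hb.
have N0 : 0 < n%:R :> R by rewrite ltr0n.
set s := (#|` S|)%:R in hb *.
have s0 : 0 <= s by rewrite ler0n.
(* The two sides are compared through their 14th powers: 22 - 14 * 58/37 = 2/37 is exactly the power
   of n spent on the harmonic sum. *)
have hN : n%:R `^ (58 / 37) <= C * s.
  (* As C >= 1, the constant survives the 14th root unchanged. *)
  have C14 : C <= C ^+ 14 by rewrite exprS ler_peMr ?(ltW C0) ?exprn_ege1.
  have q0 : 0 < n%:R `^ (2 / 37) :> R by rewrite powR_gt0.
  have h14 : (n%:R `^ (58 / 37)) ^+ 14 <= (C * s) ^+ 14.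
    apply: (@le_trans _ _ (C * s ^+ 14)); last first.
      by rewrite exprMn ler_wpM2r // exprn_ge0.
    rewrite -(ler_pM2r q0) -powR_mulrn ?powR_ge0 // -powRrM -powRD; last first.
      by apply/implyP => _; rewrite gt_eqF.
    have -> : 58 / 37 * 14%:R + 2 / 37 = 22%:R :> R by field.
    rewrite powR_mulrn ?(ltW N0) //; apply: le_trans hb _.
    have mono (a b x y z : R) : 0 <= a -> 0 <= x -> y <= b * z ->
        a * (x * y) <= a * b * x * z.
      by move=> a0 x0 yz; rewrite -!mulrA ler_wpM2l // mulrCA ler_wpM2l.
    apply: mono; [exact: le_trans K1|exact: exprn_ge0|exact: harmonic_sum_pow11_le].
  by rewrite -(ler_pXn2r (isT : (0 < 14)%N)) // nnegrE ?powR_ge0 // mulr_ge0 // ltW.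
(* For n >= 2 the logarithm is at least 1, and its exponent is negative. *)
have hlog : log2 n%:R `^ (- (20 / 37)) <= 1 :> R.
  have l1 : 1 <= log2 n%:R :> R.
    have l2 : 0 < ln 2 :> R by rewrite ln_gt0 // ltr1n.
    by rewrite /log2 ler_pdivlMr // mul1r ler_ln ?posrE // ler_nat.
  by rewrite -[leRHS](powRr0 (log2 n%:R)) ler_powR //; lra.
rewrite ler_pdivrMl //; apply: le_trans hN.
by rewrite ler_piMr // powR_ge0.
Qed.
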